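(* Let $\langle N,\{v(t)\}\rangle$ be a dynamic TU game with $N=\{1,\dots,n\}$, where each $v(t)\in\mathbb{R}^m$, $m=2^n-1$, $t=0,1,2,\dots$, is a random vector, and let $\bar v(t)=\frac{1}{t+1}\sum_{k=0}^{t}v(k)$. Assume the following. (1) Each weight matrix $A(t)=[a_{ij}(t)]$ is doubly stochastic with positive diagonal, and there exists a scalar $\alpha>0$ such that $a_{ij}(t)\ge\alpha$ whenever $a_{ij}(t)>0$. (2) There is an integer $Q\ge 1$ such that the directed graph $\left(N,\bigcup_{\tau=tQ}^{(t+1)Q-1}\mathcal{E}(\tau)\right)$ is strongly connected for every $t\ge 0$. (3) There is a vector $v^{\rm mean}\in\mathbb{R}^m$ such that with probability 1, $\lim_{t\to\infty}\bar v(t)=v^{\rm mean}$; furthermore, $v_N(t)=v^{\rm mean}_N$ for all $t$ with probability 1. (4) There exists a vector $\hat z\in C(v^{\rm mean})$ such that $\sum_{i\in S}\hat z_i>v^{\rm mean}_S$ for all nonempty $S\subsetneq N$. Let the allocations $x^i(t)$, $i\in N$, $t\ge 0$, be generated by the bargaining protocol $$x^i(t+1)=P_{\bar X_i(t)}\Big[\sum_{j=1}^n a_{ij}(t)x^j(t)\Big]\qquad\text{for all } i\in N,\ t\ge 0.$$ Then the allocations converge with probability 1 to a random allocation that lies in the core $C(v^{\rm mean})$, i.e., there is a random vector $\tilde z\in C(v^{\rm mean})$ such that with probability 1, $$\lim_{t\to\infty}\|x^i(t)-\tilde z\|=0\qquad\text{for all } i\in N.$$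
   Context: Characteristic functions are viewed as vectors $\eta\in\mathbb{R}^m$ indexed by the nonempty coalitions $S\subseteq N=\{1,\dots,n\}$, with $\eta_S$ the value of coalition $S$. The core of the TU game $\langle N,\eta\rangle$ is $$C(\eta)=\Big\{x\in\mathbb{R}^n : \sum_{i\in N}x_i=\eta_N,\ \sum_{i\in S}x_i\ge\eta_S\text{ for all nonempty }S\subsetneq N\Big\}.$$ The bounding set of player $i$ in the instantaneous average game $\langle N,\bar v(t)\rangle$ is $$\bar X_i(t)=\Big\{x\in\mathbb{R}^n : \sum_{j\in N}x_j=\bar v_N(t),\ \sum_{j\in S}x_j\ge\bar v_S(t)\text{ for all }S\subsetneq N\text{ with }i\in S\Big\},$$ and it is assumed that $\bar X_i(t)$ is nonempty for all $i\in N$ and all $t\ge 0$. $P_X[w]$ denotes the Euclidean projection of $w$ on the closed convex set $X$; $\|\cdot\|$ is the Euclidean norm. At each time $t$ there is a directed graph $\mathcal{G}(t)=(N,\mathcal{E}(t))$ (the players' neighbor-graph), with $(i,i)\in\mathcal{E}(t)$ for all $i$; a link $(i,j)\in\mathcal{E}(t)$ means that player $j$ is a neighbor of player $i$ at time $t$, i.e., player $i$ can observe the allocation of player $j$ at time $t$. The scalar $a_{ij}(t)$ is the weight that player $i$ assigns to the allocation $x^j(t)$ proposed by player $j$; the weights satisfy $a_{ij}(t)\ge 0$ if $(i,j)\in\mathcal{E}(t)$ and $a_{ij}(t)=0$ if $(i,j)\notin\mathcal{E}(t)$. A square matrix is doubly stochastic if its entries are nonnegative and all its rows and columns sum to 1.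 The initial allocations $x^i(0)\in\mathbb{R}^n$, $i\in N$, are selected randomly and independently of $\{v(t)\}$.
   Formalization: The weights are required to satisfy a_ij(t) > 0 (not merely ≥ 0) on every link (i,j) in E(t); with zero weights allowed on links the claim fails, e.g. n = 2, A(t) = I, E(t) complete, v constant with v_N = 0 and v_{1} = v_{2} = −1. *)

(* Defs.v *)
From mathcomp Require Import all_boot all_order all_algebra.
From mathcomp Require Import all_classical all_reals all_analysis.

Set Implicit Arguments.
Unset Strict Implicit.
Unset Printing Implicit Defensive.

Import Order.TTheory GRing.Theory Num.Theory.
Import numFieldNormedType.Exports.

Local Open Scope classical_set_scope.
Local Open Scope ring_scope.

(* The player set {1, ..., n} is 'I_n. *)
Notation coalition n := {S : {set 'I_n} | S != finset.set0}.
Notation ncoal n := #|{: coalition n}|.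

Lemma card_coalition (n : nat) : ncoal n = (2 ^ n - 1)%N.
Proof.
have <- : #|{: {set 'I_n}}| = (2 ^ n)%N.
  by rewrite -cardsT -powersetT card_powerset cardsT card_ord.
rewrite card_sig [in RHS](cardD1 (finset.set0 : {set 'I_n})) inE addKn.
by apply: eq_card => S; rewrite !inE andbT.
Qed.

Section TUGames.
Variables (R : realType) (n : nat).

(* The coordinate eta_S of a vector eta in R^m.  The empty set is not a
   coalition; the value 0 given to it is never used. *)
Definition worth (eta : 'rV[R]_(ncoal n)) (S : {set 'I_n}) : R :=
  if insub S : option (coalition n) is Some c then eta 0 (enum_rank c) else 0.

Definition payoff (x : 'rV[R]_n) (S : {set 'I_n}) : R :=
  \sum_(i in S) x 0 i.

Definition core (eta : 'rV[R]_(ncoal n)) : set 'rV[R]_n :=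
  [set x | payoff x [set: 'I_n]%SET = worth eta [set: 'I_n]%SET /\
    forall S : {set 'I_n}, S != finset.set0 -> S \proper [set: 'I_n]%SET ->
      worth eta S <= payoff x S].

Definition bounding_set (eta : 'rV[R]_(ncoal n)) (i : 'I_n) : set 'rV[R]_n :=
  [set x | payoff x [set: 'I_n]%SET = worth eta [set: 'I_n]%SET /\
    forall S : {set 'I_n}, S \proper [set: 'I_n]%SET -> i \in S ->
      worth eta S <= payoff x S].

Definition doubly_stochastic (A : 'M[R]_n) : Prop :=
  [/\ forall i j, 0 <= A i j,
      forall i, \sum_j A i j = 1 &
      forall j, \sum_i A i j = 1].

End TUGames.

(* The library norm on row vectors is the sup norm. *)
Definition enorm (R : realType) (n : nat) (x : 'rV[R]_n) : R :=
  Num.sqrt (\sum_i x 0 i ^+ 2).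

(* The default value w is reached only if no nearest point exists, which does
   not happen for a nonempty closed X. *)
Definition eproj (R : realType) (n : nat) (X : set 'rV[R]_n) (w : 'rV[R]_n) :
    'rV[R]_n :=
  xget w [set y | X y /\ forall z, X z -> enorm (w - y) <= enorm (w - z)].

Definition average (R : realType) (m : nat) (u : nat -> 'rV[R]_m) (t : nat) :
    'rV[R]_m :=
  t.+1%:R^-1 *: \sum_(0 <= k < t.+1) u k.

Definition strongly_connected (T : finType) (E : {set T * T}) : Prop :=
  forall i j : T, connect [rel a b | (a, b) \in E] i j.

Section RandomVectors.
Context {d : measure_display} {Omega : measurableType d} {R : realType}.

(* Coordinatewise measurability, i.e. measurability for the Borel sigma-algebra
   of R^m (row vectors carry no measurable structure in the library). *)
Definition random_vector (m : nat) (X : Omega -> 'rV[R]_m) : Prop :=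
  forall k : 'I_m, measurable_fun [set: Omega] (fun w => X w 0 k).

Definition sigma_generated (I : Type) (m : nat) (X : I -> Omega -> 'rV[R]_m) :
    set (set Omega) :=
  <<s \bigcup_(i in [set: I]) \bigcup_(k in [set: 'I_m])
        g_sigma_algebra_preimage (fun w => X i w 0 k) >>.

Definition independent_families (P : probability Omega R) (I J : Type)
    (m p : nat) (X : I -> Omega -> 'rV[R]_m) (Y : J -> Omega -> 'rV[R]_p) :
    Prop :=
  forall A B : set Omega, sigma_generated X A -> sigma_generated Y B ->
    P (A `&` B) = (P A * P B)%E.

End RandomVectors.

(* Main.v *)
Require Import Defs.
From mathcomp Require Import all_boot all_order all_algebra.
From mathcomp Require Import all_classical all_reals all_analysis.
From mathcomp Require Import measurable_realfun ring lra.
Import Order.TTheory GRing.Theory Num.Theory.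
Import numFieldNormedType.Exports.
Local Open Scope classical_set_scope.
Local Open Scope ring_scope.

(** On the almost sure event where the hypotheses hold, put
    V_z(t) = sum_i |x^i(t) - z|^2.  By strictness of zhat, every z of the
    efficient hyperplane close to zhat eventually lies in all bounding sets, so
    the obtuse angle property of projections and double stochasticity give
    V_z(t+1) + residual(t) <= V_z(t), where the residual collects the
    projection errors |x^i(t+1) - w^i(t)|^2 and the weighted spreads
    a_ij |x^j(t) - w^i(t)|^2 around the averages w^i.  Hence:
    - the residuals tend to 0, and connectivity over windows of length Q forces
      consensus x^i(t) - x^j(t) -> 0;
    - V_z converges for each such z; V_z - V_zhat is affine in sum_i x^i(t), and
      the vectors z - zhat span the direction of the hyperplane, so sum_i x^i(t)
      converges.
    The common limit satisfies every core constraint, since each coalition S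
    constrains the players i in S at all times.

    Measurability of the limit reduces to that of the projection onto a random
    polyhedron: by compactness, {t | exists z, g t z <= 0} is a countable
    combination of the sets {t | g t q < 1/m} with q rational, for g continuous
    and coercive in z. *)

(** * Euclidean projections *)

Section Geometry.
Context {R : realType} {n : nat}.
Implicit Types (x y z w p : 'rV[R]_n) (X : set 'rV[R]_n).

(** The square of [enorm], polynomial in the coordinates, so that distances can be compared and
    expanded without square roots. *)
Definition sqnorm x : R := \sum_i x 0 i ^+ 2.

Lemma sqnorm_ge0 x : 0 <= sqnorm x.
Proof. by apply: sumr_ge0 => i _; exact: sqr_ge0. Qed.

Lemma sqr_coord_le x i : x 0 i ^+ 2 <= sqnorm x.
Proof.
rewrite /sqnorm (bigD1 i) //= lerDl.
by apply: sumr_ge0 => j _; exact: sqr_ge0.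
Qed.

Lemma sqnorm_eq0 x : sqnorm x = 0 -> x = 0.
Proof.
move=> x0; apply/rowP => i; rewrite mxE; apply/eqP.
by rewrite -sqrf_eq0 eq_le sqr_ge0 andbT -x0 sqr_coord_le.
Qed.

Lemma enorm_le x y : (enorm x <= enorm y) = (sqnorm x <= sqnorm y).
Proof. exact: ler_sqrt (sqnorm_ge0 y). Qed.

Lemma continuous_coord i : continuous (fun x => x 0 i).
Proof. exact: coord_continuous. Qed.

Lemma continuous_sum {T : topologicalType} (I : Type) (r : seq I) (P : pred I)
    (f : I -> T -> R) :
  (forall i, continuous (f i)) -> continuous (fun t => \sum_(i <- r | P i) f i t).
Proof. by move=> fc t; apply: cvg_big => [|i _]; [exact: add_continuous|exact: fc]. Qed.

Lemma continuous_add {T : topologicalType} (f g : T -> R) :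
  continuous f -> continuous g -> continuous (fun t => f t + g t).
Proof. by move=> fc gc t; apply: cvgD; [exact: fc|exact: gc]. Qed.

Lemma continuous_sub {T : topologicalType} (f g : T -> R) :
  continuous f -> continuous g -> continuous (fun t => f t - g t).
Proof. by move=> fc gc t; apply: cvgB; [exact: fc|exact: gc]. Qed.

Lemma continuous_const {T : topologicalType} (c : R) : continuous (fun _ : T => c).
Proof. by move=> t; exact: cvg_cst. Qed.

Lemma continuous_sqdist w : continuous (fun z => sqnorm (w - z)).
Proof.
apply: continuous_sum => i z.
have coordB : continuous (fun z => (w - z) 0 i).
  rewrite (_ : (fun z => _) = (fun z => w 0 i - z 0 i)).
    by apply: continuous_sub; [exact: continuous_const|exact: continuous_coord].
  by apply/funext => u; rewrite !mxE.
exact: (continuous_comp (coordB z) (@exprn_continuous R 2 _)).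
Qed.

Lemma coord_le_norm x i : `|x 0 i| <= `|x|.
Proof.
rewrite [leRHS]/Num.Def.normr/= mx_normrE.
exact: (le_bigmax _ (fun ij : 'I_1 * 'I_n => `|x ij.1 ij.2|) (0, i)).
Qed.

Lemma norm_le_coord x (M : R) : 0 <= M -> (forall i, `|x 0 i| <= M) -> `|x| <= M.
Proof.
move=> M0 xM; rewrite [leLHS]/Num.Def.normr/= mx_normrE.
by apply/bigmax_leP; split=> // -[i j] _; rewrite ord1.
Qed.

(** Each coordinate satisfies [r ^+ 2 <= c], hence [|r| <= 1 + c], which avoids the root of [c].
    This turns Euclidean bounds into boundedness for the sup norm. *)
Lemma norm_le_sqdist w z (c : R) : 0 <= c -> sqnorm (w - z) <= c ->
  `|z| <= `|w| + (1 + c).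
Proof.
move=> c0 wzc; apply: norm_le_coord => [|i]; first by rewrite !addr_ge0.
have := le_trans (sqr_coord_le (w - z) i) wzc; rewrite !mxE => h.
have := coord_le_norm w i; rewrite ler_norml => /andP[h1 h2].
by rewrite ler_norml; apply/andP; split; nra.
Qed.

(** The part of [X] in the sublevel set of [z0] is compact, so [f] has a minimum there; elsewhere on
    [X] the values exceed [f z0]. *)
Lemma closed_coercive_min (f : 'rV[R]_n -> R) X z0 (M : R) :
  continuous f -> closed X -> X z0 -> (forall z, f z <= f z0 -> `|z| <= M) ->
  exists2 y, X y & forall z, X z -> f y <= f z.
Proof.
move=> fc Xc Xz0 fM.
have [||y|y] := @EVT_min_rV R n f (X `&` [set z | f z <= f z0]).
- by exists z0; split => //=.
- apply: bounded_closed_compact.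
    exists M; split; first exact: num_real.
    by move=> N MN z [_ /fM] zM; exact: le_trans zM (ltW MN).
  apply: closedI => //.
  apply: (@preimage_closed _ _ f [set r | r <= f z0]) => [z _|]; first exact: fc.
  exact: closed_le.
- exact: continuous_subspaceT.
- rewrite inE => -[Xy /= yz0] ymin; exists y => // z Xz.
  have [zz0|/ltW zz0] := leP (f z) (f z0); last exact: le_trans yz0 zz0.
  by apply: ymin; rewrite inE.
Qed.

(** Squared distance to [w] is coercive, so a nearest point exists and [xget] does not fall back on
    its default. *)
Lemma eproj_nearest X w : closed X -> X !=set0 ->
  X (eproj X w) /\ forall z, X z -> sqnorm (w - eproj X w) <= sqnorm (w - z).
Proof.
move=> Xc [z0 Xz0].
have [|y Xy ymin] := @closed_coercive_min _ X z0 (`|w| + (1 + sqnorm (w - z0)))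
  (continuous_sqdist w) Xc Xz0.
  by move=> z; apply: norm_le_sqdist; exact: sqnorm_ge0.
rewrite /eproj.
set Y := [set _ | _]; have [] : Y (xget w Y).
  by apply: xgetPex; exists y; split=> // z Xz; rewrite enorm_le; exact: ymin.
by move=> ? h; split=> // z Xz; rewrite -enorm_le; exact: h.
Qed.

Definition convex_set X :=
  forall x y (s : R), X x -> X y -> 0 <= s <= 1 -> X (x + s *: (y - x)).

(* Minimality along the segment from [p] to [z] gives [<w - p, z - p> <= 0]. *)
Lemma nearest_obtuse X w p z : convex_set X -> X p ->
  (forall y, X y -> sqnorm (w - p) <= sqnorm (w - y)) -> X z ->
  sqnorm (p - z) + sqnorm (p - w) <= sqnorm (w - z).
Proof.
move=> Xcv Xp pmin Xz.
pose c := \sum_i (w 0 i - p 0 i) * (z 0 i - p 0 i).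
have expand s : sqnorm (w - (p + s *: (z - p))) =
    sqnorm (p - w) - s * c *+ 2 + s ^+ 2 * sqnorm (p - z).
  rewrite /sqnorm /c mulr_sumr -sumrMnl mulr_sumr -sumrB -big_split/=.
  by apply: eq_bigr => i _; rewrite !mxE; ring.
have sqC y : sqnorm (w - y) = sqnorm (y - w).
  by apply: eq_bigr => i _; rewrite !mxE; ring.
have sq0 := sqnorm_ge0 (p - z).
have cs s : 0 <= s <= 1 -> s * c *+ 2 <= s ^+ 2 * sqnorm (p - z).
  move=> s01; have := pmin _ (Xcv p z s Xp Xz s01).
  by rewrite expand sqC; lra.
have c_le0 : c <= 0.
  rewrite leNgt; apply/negP => c0.
  have d0 : 0 < c + sqnorm (p - z) by rewrite ltr_wpDr.
  (* The denominator keeps [s] at most 1. Moreover [s * sqnorm (p - z) <= c], whereas [cs s] would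
     force it to be at least [2 * c]. *)
  pose s := c / (c + sqnorm (p - z)).
  have s0 : 0 < s by rewrite divr_gt0.
  have s1 : s <= 1 by rewrite ler_pdivrMr// mul1r lerDl.
  have sE : s * (c + sqnorm (p - z)) = c by rewrite divfK// gt_eqF.
  have := cs s; rewrite (ltW s0) s1 => /(_ isT).
  by rewrite expr2 -mulrnAr -mulrA ler_pM2l//; nra.
have := expand 1; rewrite scale1r subrKC => ->; lra.
Qed.
End Geometry.

(** * Consensus, and the bounding polyhedra *)

Lemma mem_bigcup_seq (I T : finType) (J : eqType) (r : seq J) (F : J -> {set T}) (x : T) :
  x \in (\bigcup_(j <- r) F j)%SET -> exists2 j, j \in r & x \in F j.
Proof.
elim: r => [|j r IHr]; first by rewrite big_nil inE.
rewrite big_cons inE => /orP[xj|/IHr[k kr xk]].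
  by exists j => //; rewrite mem_head.
by exists k => //; rewrite in_cons kr orbT.
Qed.

(** All values are compared at the start [s] of the window containing [t]. Slow variation transports
    each link of the window to time [s], a path of links then joins [i] to [j], and slow variation
    leads back to [t]. *)
Lemma consensus (R : realType) (T : finType) (E : nat -> {set T * T}) (Q : nat)
    (y : nat -> T -> R) :
  (0 < Q)%N ->
  (forall q, strongly_connected (\bigcup_(q * Q <= tau < q.+1 * Q) E tau)%SET) ->
  (forall eps, 0 < eps -> \forall t \near \oo, forall i, `|y t.+1 i - y t i| <= eps) ->
  (forall eps, 0 < eps ->
    \forall t \near \oo, forall i j, (i, j) \in E t -> `|y t i - y t j| <= eps) ->
  forall i j, y t i - y t j @[t --> \oo] --> 0.
Proof.
move=> Q0 Econ ystep ylink i j; apply/cvgrPdist_le => eps eps0.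
(* In units of [e], a link moved to time [s] costs itself plus two drifts of at most [Q] steps,
   which is [c]. Then [C] adds up at most [#|T|] links and the two drifts from [s] to [t]; its final
   1 gives positivity. *)
pose c : R := (Q + Q).+1%:R.
pose C : R := (#|T|%:R * c + (Q + Q)%:R) + 1.
have C0 : 0 < C by rewrite ltr_wpDl// addr_ge0// mulr_ge0.
pose e := eps / C.
have e0 : 0 < e by rewrite divr_gt0.
have [N _ HN] : \forall t \near \oo, (forall i, `|y t.+1 i - y t i| <= e) /\
    (forall i j, (i, j) \in E t -> `|y t i - y t j| <= e).
  by apply: filterI; [exact: ystep|exact: ylink].
have drift s m k : (N <= s)%N -> `|y (s + m)%N k - y s k| <= m%:R * e.
  move=> Ns; elim: m => [|m IHm]; first by rewrite addn0 subrr normr0 mul0r.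
  rewrite addnS (_ : _ - _ =
    (y (s + m).+1 k - y (s + m)%N k) + (y (s + m)%N k - y s k)); last by ring.
  rewrite (le_trans (ler_normD _ _))// -natr1 mulrDl mul1r addrC lerD//.
  by apply: (HN (s + m)%N _).1; rewrite /= (leq_trans Ns)// leq_addr.
(* Past [N * Q] the window index [q] is at least [N], and so is the starting time [s]. *)
exists (N * Q)%N => // t /= NQt; rewrite sub0r normrN.
pose q := (t %/ Q)%N; pose s := (q * Q)%N.
have Nq : (N <= q)%N by rewrite leq_divRL.
have Ns : (N <= s)%N by rewrite (leq_trans Nq)// leq_pmulr.
have link a b : (a, b) \in (\bigcup_(q * Q <= tau < q.+1 * Q) E tau)%SET ->
    `|y s a - y s b| <= c * e.
  move=> /(@mem_bigcup_seq T)[tau]; rewrite mem_index_iota => /andP[stau tauQ] abE.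
  have tauE : tau = (s + (tau - s))%N by rewrite subnKC.
  have mQ : (tau - s <= Q)%N by rewrite leq_subLR -mulSnr ltnW.
  have := drift s (tau - s)%N a Ns; have := drift s (tau - s)%N b Ns.
  rewrite -tauE => da db.
  have dab := (HN tau (leq_trans Ns stau)).2 _ _ abE.
  have me : (tau - s)%:R * e <= Q%:R * e by rewrite ler_pM2r// ler_nat.
  rewrite (_ : y s a - y s b =
    (y tau a - y tau b) - (y tau a - y s a) + (y tau b - y s b)); last by ring.
  rewrite (le_trans (ler_normD _ _))// /c -natr1 natrD !mulrDl mul1r.
  have := ler_normB (y tau a - y tau b) (y tau a - y s a); lra.
have path_bound a p :
    path [rel a b | (a, b) \in (\bigcup_(q * Q <= tau < q.+1 * Q) E tau)%SET] a p ->
    `|y s a - y s (last a p)| <= (size p)%:R * (c * e).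
  elim: p a => [|b p IHp] a /=; first by rewrite subrr normr0 mul0r.
  move=> /andP[/link ab /IHp bp]; rewrite -natr1 mulrDl mul1r.
  rewrite (_ : _ - _ = (y s a - y s b) + (y s b - y s (last b p))); last by ring.
  by rewrite (le_trans (ler_normD _ _))// addrC lerD.
have sync : `|y s i - y s j| <= #|T|%:R * (c * e).
  have /connectP[p pP ->] := Econ q i j.
  (* Without repeated vertices the path has fewer than [#|T|] links. *)
  case: (shortenP pP) => p' p'P /card_uniqP p'u _.
  apply: (le_trans (path_bound _ _ p'P)).
  apply: ler_wpM2r; first by rewrite mulr_ge0// ltW.
  rewrite ler_nat; apply: (leq_trans (leqnSn _)).
  by rewrite -[X in (X <= _)%N]p'u max_card.
have tE : t = (s + t %% Q)%N by rewrite /s /q -divn_eq.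
have := drift s (t %% Q)%N i Ns; have := drift s (t %% Q)%N j Ns.
rewrite -tE => dj di.
have me : (t %% Q)%:R * e <= Q%:R * e by rewrite ler_pM2r// ler_nat ltnW// ltn_pmod.
rewrite (_ : y t i - y t j =
  (y s i - y s j) - (y t j - y s j) + (y t i - y s i)); last by ring.
have -> : eps = C * e by rewrite /e mulrC divfK// gt_eqF.
rewrite (le_trans (ler_normD _ _))// /C natrD !mulrDl mul1r.
have := ler_normB (y s i - y s j) (y t j - y s j); lra.
Qed.

Section Average.
Context {R : realType} {n : nat}.
Implicit Types (z : 'rV[R]_n) (a : 'I_n -> R) (y : 'I_n -> 'rV[R]_n).

(** The parallel axis identity: in each coordinate the cross term vanishes because [w] is the
    barycenter. Being an equality, it yields the spread around [w] as a quantifiable loss. *)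
Lemma sqnorm_barycenter a y z : \sum_j a j = 1 ->
  let w := \sum_j a j *: y j in
  sqnorm (w - z) + \sum_j a j * sqnorm (y j - w) = \sum_j a j * sqnorm (y j - z).
Proof.
move=> a1 w; rewrite /sqnorm.
under [X in _ + X = _]eq_bigr do rewrite mulr_sumr.
under [in RHS]eq_bigr do rewrite mulr_sumr.
rewrite [X in _ + X = _]exchange_big [RHS]exchange_big -big_split/=.
apply: eq_bigr => k _; set m := w 0 k.
have mE : \sum_j a j * y j 0 k = m.
  by rewrite /m /w summxE; apply: eq_bigr => j _; rewrite mxE.
have -> : \sum_j a j * (y j - w) 0 k ^+ 2 =
    \sum_j a j * y j 0 k ^+ 2 - m *+ 2 * \sum_j a j * y j 0 k + m ^+ 2 * \sum_j a j.
  rewrite !mulr_sumr -sumrB -big_split/=; apply: eq_bigr => j _.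
  by rewrite !mxE -/m; ring.
have -> : \sum_j a j * (y j - z) 0 k ^+ 2 =
    \sum_j a j * y j 0 k ^+ 2 - z 0 k *+ 2 * \sum_j a j * y j 0 k
    + z 0 k ^+ 2 * \sum_j a j.
  rewrite !mulr_sumr -sumrB -big_split/=; apply: eq_bigr => j _.
  by rewrite !mxE; ring.
by rewrite mE a1 !mxE -/m; ring.
Qed.

End Average.

Section Polyhedra.
Context {R : realType} {n : nat}.
Implicit Types (eta : 'rV[R]_(ncoal n)) (x y : 'rV[R]_n) (S : {set 'I_n}).

(** Convergence, averaging and measurability of a worth thus reduce to a fixed coordinate, the
    default value at the empty set being the second case. *)
Lemma worthE S :
  (exists c, forall eta, worth eta S = eta 0 c) \/ (forall eta, worth eta S = 0).
Proof. by rewrite /worth; case: insub => [c|]; [left; exists (enum_rank c)|right]. Qed.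

Lemma cvg_worth (b : nat -> 'rV[R]_(ncoal n)) eta S :
  b t @[t --> \oo] --> eta -> worth (b t) S @[t --> \oo] --> worth eta S.
Proof.
have [[c wE]|wE] := worthE S => cb.
  rewrite wE; under eq_fun do rewrite wE.
  exact: (@cvg_comp _ _ _ b (fun x : 'rV_ _ => x 0 c) _ _ _ cb
    (@continuous_coord _ _ c eta)).
by rewrite wE; under eq_fun do rewrite wE; exact: cvg_cst.
Qed.

Lemma worth_average (u : nat -> 'rV[R]_(ncoal n)) S (c : R) t :
  (forall k, worth (u k) S = c) -> worth (average u t) S = c.
Proof.
have [[i wE]|wE] := worthE S => uc; last by rewrite wE -(uc 0%N) wE.
rewrite wE mxE summxE (eq_bigr (fun=> c)) => [|k _]; last by rewrite -wE.
by rewrite sumr_const_nat subn0 -[c *+ _]mulr_natl mulrA mulVf ?mul1r// pnatr_eq0.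
Qed.

Lemma payoffD x y S : payoff (x + y) S = payoff x S + payoff y S.
Proof. by rewrite /payoff -big_split; apply: eq_bigr => i _; rewrite mxE. Qed.

Lemma payoffZ (s : R) x S : payoff (s *: x) S = s * payoff x S.
Proof. by rewrite /payoff mulr_sumr; apply: eq_bigr => i _; rewrite mxE. Qed.

Lemma continuous_payoff S : continuous (fun x => payoff x S).
Proof. by apply: continuous_sum => i; exact: continuous_coord. Qed.

Lemma closed_bounding_set eta i : closed (bounding_set eta i).
Proof.
have -> : bounding_set eta i =
    ((fun x => payoff x [set: 'I_n]%SET) @^-1` [set worth eta [set: 'I_n]%SET])
    `&` \bigcap_(S in [set S : {set 'I_n} | S \proper [set: 'I_n]%SET /\ i \in S])
          ((fun x => payoff x S) @^-1` [set r | worth eta S <= r]).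
  apply/seteqP; split=> x [xN xS]; split=> // S.
    by case=> ? ?; exact: xS.
  by move=> ? ?; exact: xS.
apply: closedI.
  by apply: preimage_closed => [z _|]; [exact: continuous_payoff|exact: closed_eq].
apply: closed_bigI => S _; apply: preimage_closed => [z _|].
  exact: continuous_payoff.
exact: closed_ge.
Qed.

Lemma convex_bounding_set eta i : convex_set (bounding_set eta i).
Proof.
move=> x y s [xN xS] [yN yS] /andP[s0 s1]; split=> [|S pS iS];
    rewrite payoffD payoffZ payoffD -scaleN1r payoffZ.
  by rewrite xN yN; ring.
by have := xS S pS iS; have := yS S pS iS; nra.
Qed.

End Polyhedra.

(** * Convergence along one trajectory *)

Section Bargaining.
Context {R : realType} {n : nat}.
Variables (E : nat -> {set 'I_n * 'I_n}) (A : nat -> 'M[R]_n) (alpha : R) (Q : nat).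
Hypothesis n_gt0 : (0 < n)%N.
Hypothesis E_refl : forall t (i : 'I_n), (i, i) \in E t.
Hypothesis A_stochastic : forall t, doubly_stochastic (A t).
Hypothesis alpha_gt0 : 0 < alpha.
Hypothesis A_link : forall t i j, (i, j) \in E t -> alpha <= A t i j.
Hypothesis Q_gt0 : (0 < Q)%N.
Hypothesis E_connected : forall t,
  strongly_connected (\bigcup_(t * Q <= tau < t.+1 * Q) E tau)%SET.
Variables (b : nat -> 'rV[R]_(ncoal n)) (bm : 'rV[R]_(ncoal n)).
Hypothesis cvg_b : b t @[t --> \oo] --> bm.
Hypothesis b_grand : forall t,
  worth (b t) [set: 'I_n]%SET = worth bm [set: 'I_n]%SET.
Hypothesis b_neq0 : forall t i, bounding_set (b t) i !=set0.
Variables (zhat : 'rV[R]_n).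
Hypothesis zhat_grand : payoff zhat [set: 'I_n]%SET = worth bm [set: 'I_n]%SET.
Hypothesis zhat_strict : forall S : {set 'I_n}, S != finset.set0 ->
  S \proper [set: 'I_n]%SET -> worth bm S < payoff zhat S.
Variables (x : nat -> 'I_n -> 'rV[R]_n).
Let w t i := \sum_j A t i j *: x t j.
Hypothesis x_protocol : forall t i, x t.+1 i = eproj (bounding_set (b t) i) (w t i).

Let V z t := \sum_i sqnorm (x t i - z).
Let residual t :=
  \sum_i (sqnorm (x t.+1 i - w t i) + \sum_j A t i j * sqnorm (x t j - w t i)).

Let A_ge0 t i j : 0 <= A t i j. Proof. by case: (A_stochastic t). Qed.

Let allocation_bounding t i : bounding_set (b t) i (x t.+1 i).
Proof.
rewrite x_protocol.
by have [] := eproj_nearest _ (w t i) (closed_bounding_set (b t) i) (b_neq0 t i).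
Qed.

(** Unit column sums rewrite [V z t] as the sum over [i] of weighted squared distances. Unit row
    sums split each of them by the parallel axis identity, and the obtuse angle property bounds the
    remaining term [sqnorm (w t i - z)] from below. *)
Let descent z t : (forall i, bounding_set (b t) i z) -> V z t.+1 + residual t <= V z t.
Proof.
move=> zX.
have -> : V z t = \sum_i \sum_j A t i j * sqnorm (x t j - z).
  rewrite exchange_big; apply: eq_bigr => j _.
  by rewrite -mulr_suml; case: (A_stochastic t) => _ _ ->; rewrite mul1r.
rewrite /V /residual -big_split; apply: ler_sum => i _ /=.
have [Xp pmin] := eproj_nearest _ (w t i) (closed_bounding_set (b t) i) (b_neq0 t i).
have := nearest_obtuse _ _ _ _ (convex_bounding_set (b t) i) Xp pmin (zX i).
rewrite -x_protocol => obt.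
have [_ A1 _] := A_stochastic t.
have := sqnorm_barycenter _ (fun j => x t j) z (A1 i).
rewrite /= -/(w t i) => <-; lra.
Qed.

Let residual_ge0 t : 0 <= residual t.
Proof.
apply: sumr_ge0 => i _; rewrite addr_ge0 ?sqnorm_ge0//.
by apply: sumr_ge0 => j _; rewrite mulr_ge0 ?sqnorm_ge0.
Qed.

(** By [descent] the sequence is eventually nonincreasing, and 0 bounds it from below. *)
Let V_cvg z : (\forall t \near \oo, forall i, bounding_set (b t) i z) -> cvgn (V z).
Proof.
move=> [N _ zX]; apply: (@near_nonincreasing_is_cvgn _ _ 0); last first.
  by apply: nearW => t; apply: sumr_ge0 => i _; exact: sqnorm_ge0.
exists N => //= s Ns t; elim: t => [|t IHt]; first by rewrite leqn0 => /eqP ->.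
rewrite leq_eqVlt => /predU1P[->//|]; rewrite ltnS => st.
apply: le_trans (IHt st); have := descent _ _ (zX t (leq_trans Ns st)).
by have := residual_ge0 t; lra.
Qed.

(** There are finitely many coalitions, so one [delta] fits below all the strict gaps at [zhat] and
    one time makes all the averaged worths close enough. *)
Let interior_slack : exists2 delta : R, 0 < delta &
  \forall t \near \oo, forall y, payoff y [set: 'I_n]%SET = 0 ->
    (forall S, `|payoff y S| <= delta) -> forall i, bounding_set (b t) i (zhat + y).
Proof.
have [delta [delta0 gap]] : exists delta : R, 0 < delta /\
    forall S : {set 'I_n}, S != finset.set0 -> S \proper [set: 'I_n]%SET ->
      worth bm S + delta < payoff zhat S.
  near (0 : R)^'+ => delta; exists delta; split => //.
  near: delta; apply: filter_forall => S.
  have [S0|S0] := boolP (S == finset.set0); first exact: nearW.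
  have [Sp|Sp] := boolP (S \proper [set: 'I_n]%SET); last exact: nearW.
  near=> delta => _ _; rewrite -ltrBrDl; near: delta.
  by apply: nbhs_right_lt; rewrite subr_gt0; exact: zhat_strict.
exists delta => //.
have : \forall t \near \oo, forall S : {set 'I_n}, S != finset.set0 ->
    S \proper [set: 'I_n]%SET -> worth (b t) S <= payoff zhat S - delta.
  apply: filter_forall => S.
  have [S0|S0] := boolP (S == finset.set0); first exact: nearW.
  have [Sp|Sp] := boolP (S \proper [set: 'I_n]%SET); last exact: nearW.
  have lt_gap : worth bm S < payoff zhat S - delta by rewrite ltrBrDr gap.
  have le_gap : \forall t \near \oo, worth (b t) S <= payoff zhat S - delta.
    exact: (cvgr_le _ (cvg_worth b bm S cvg_b) _ lt_gap).
  by apply: filterS le_gap.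
apply: filterS => t bt y y0 yS i; split=> [|S Sp iS]; rewrite payoffD.
  by rewrite y0 addr0 zhat_grand b_grand.
have Sn0 : S != finset.set0 by apply/set0Pn; exists i.
have := bt S Sn0 Sp; have := yS S; rewrite ler_norml => /andP[]; lra.
Unshelve. all: by end_near. Qed.

Let zhat_bounding : \forall t \near \oo, forall i, bounding_set (b t) i zhat.
Proof.
have [delta /ltW d0] := interior_slack; apply: filterS => t /(_ 0).
have p0 S : payoff (0 : 'rV[R]_n) S = 0 by apply: big1 => i _; rewrite mxE.
by rewrite addr0; apply => // S; rewrite p0 normr0.
Qed.

(** Eventually the residual lies between 0 and the decrease of the convergent sequence [V zhat]. *)
Let residual_cvg0 : residual t @[t --> \oo] --> 0.
Proof.
have /cvg_ex[l Vl] := V_cvg _ zhat_bounding.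
apply: (@squeeze_cvgr _ _ _ _ (fun=> 0) (fun t => V zhat t - V zhat t.+1)).
- move: zhat_bounding; apply: filterS => t zX; rewrite residual_ge0/=.
  by have := descent _ _ zX; lra.
- exact: cvg_cst.
- rewrite -(subrr l); apply: cvgB => //.
  by move: Vl; rewrite -(cvg_shiftS (V zhat)).
Qed.

Let residual_coord eps : 0 < eps -> \forall t \near \oo,
  (forall i k, `|x t.+1 i 0 k - w t i 0 k| <= eps) /\
  (forall i j k, (i, j) \in E t -> `|x t j 0 k - w t i 0 k| <= eps).
Proof.
move=> eps0.
have small (u : R) : u ^+ 2 <= eps ^+ 2 -> `|u| <= eps.
  by rewrite -(real_normK (num_real u)) ler_sqr ?nnegrE// ltW.
(* Projection errors enter the residual with coefficient 1 and spreads along links with weight at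
   least [alpha]; the minimum serves both. *)
have : \forall t \near \oo, residual t <= Num.min 1 alpha * eps ^+ 2.
  apply: (cvgr_le _ residual_cvg0).
  by rewrite mulr_gt0// ?exprn_gt0// lt_min ltr01.
apply: filterS => t.
rewrite /residual => resid.
have part i : sqnorm (x t.+1 i - w t i) + \sum_j A t i j * sqnorm (x t j - w t i)
    <= Num.min 1 alpha * eps ^+ 2.
  apply: le_trans resid; rewrite [leRHS](bigD1 i)//= lerDl; apply: sumr_ge0 => j _.
  by rewrite addr_ge0 ?sqnorm_ge0// sumr_ge0// => k _; rewrite mulr_ge0 ?sqnorm_ge0.
have sum_ge0 i : 0 <= \sum_j A t i j * sqnorm (x t j - w t i).
  by rewrite sumr_ge0// => k _; rewrite mulr_ge0 ?sqnorm_ge0.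
have min1 : Num.min 1 alpha <= 1 by rewrite ge_min lexx.
have mina : Num.min 1 alpha <= alpha by rewrite ge_min lexx orbT.
have eps2 : 0 < eps ^+ 2 by rewrite exprn_gt0.
split=> [i k|i j k ijE]; apply: small.
  have := sqr_coord_le (x t.+1 i - w t i) k; rewrite 2!mxE.
  by have := part i; have := sum_ge0 i; nra.
have := sqr_coord_le (x t j - w t i) k; rewrite 2!mxE => le1; apply: (le_trans le1).
rewrite -(ler_pM2l alpha_gt0).
apply: (@le_trans _ _ (A t i j * sqnorm (x t j - w t i))).
  by rewrite ler_wpM2r ?sqnorm_ge0// A_link.
apply: (@le_trans _ _ (Num.min 1 alpha * eps ^+ 2)); last by rewrite ler_wpM2r// ltW.
apply: le_trans (part i); rewrite (bigD1 j)//= addrCA lerDl addr_ge0 ?sqnorm_ge0//.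
by apply: sumr_ge0 => l _; rewrite mulr_ge0 ?sqnorm_ge0.
Qed.

(** The self-loops keep each allocation close to its own average [w]. Combined with the projection
    errors this gives slow variation, and combined with the spreads it gives agreement along links,
    which is what [consensus] requires. *)
Let agreement i j k : x t i 0 k - x t j 0 k @[t --> \oo] --> 0.
Proof.
apply: (@consensus R 'I_n E Q (fun t i => x t i 0 k)) => // eps eps0.
  have : \forall t \near \oo, _ := residual_coord _ (divr_gt0 eps0 (ltr0Sn _ 1)).
  apply: filterS => t [xw xlink] a.
  have := ler_normB (x t.+1 a 0 k - w t a 0 k) (x t a 0 k - w t a 0 k).
  have := xw a k; have := xlink a a k (E_refl t a).
  rewrite opprB addrA subrK; lra.
have : \forall t \near \oo, _ := residual_coord _ (divr_gt0 eps0 (ltr0Sn _ 1)).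
apply: filterS => t [xw xlink] a c acE.
have := ler_normB (x t a 0 k - w t a 0 k) (x t c 0 k - w t a 0 k).
have := xlink a c k acE; have := xlink a a k (E_refl t a).
rewrite opprB addrA subrK; lra.
Qed.

Let total k t := \sum_i x t i 0 k.

(* [V z - V zhat] is affine in the totals, so moving [zhat] by a small transfer
   from [l] to [k] isolates [total k - total l]. *)
Let total_diff_cvg k l : cvgn (fun t => total k t - total l t).
Proof.
have [delta delta0 slack] := interior_slack.
pose e : 'rV[R]_n := \row_m (((m == k)%:R - (m == l)%:R) : R).
pose y := delta *: e.
(* Used with membership in a coalition for the payoffs of [y], and with [predT] for the inner
   product in [Vdiff]. *)
have sum_diff (P : pred 'I_n) (f : 'I_n -> R) :
    \sum_(m | P m) f m * e 0 m = (P k)%:R * f k - (P l)%:R * f l.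
  have one a : \sum_(m | P m) f m * (m == a)%:R = (P a)%:R * f a.
    rewrite big_mkcond (bigD1 a)//= eqxx mulr1 big1 ?addr0.
      by case: (P a); rewrite ?mul1r ?mul0r.
    by move=> m /negbTE ->; rewrite mulr0 if_same.
  by rewrite -!one -sumrB; apply: eq_bigr => m _; rewrite mxE mulrBr.
have payoff_y S : payoff y S = delta * ((k \in S)%:R - (l \in S)%:R).
  rewrite payoffZ; congr (_ * _); have := sum_diff (mem S) (fun=> 1).
  by rewrite !mulr1 => <-; apply: eq_bigr => m _; rewrite mul1r.
have zy : \forall t \near \oo, forall i, bounding_set (b t) i (zhat + y).
  move: slack; apply: filterS => t; apply; first by rewrite payoff_y !inE subrr mulr0.
  move=> S; rewrite payoff_y normrM (gtr0_norm delta0) ger_pMr//.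
  by case: (k \in S) (l \in S) => -[]; rewrite ?subrr ?subr0 ?sub0r ?normrN ?normr0 ?normr1.
have Vdiff t : V (zhat + y) t - V zhat t =
    n%:R * (sqnorm y + delta * (zhat 0 k - zhat 0 l) *+ 2)
    - delta *+ 2 * (total k t - total l t).
  rewrite /V /total -[in n%:R](card_ord n) mulr_natl -sumr_const -!sumrB mulr_sumr -sumrB.
  apply: eq_bigr => i _; rewrite /sqnorm -sumrB.
  have -> : \sum_m ((x t i - (zhat + y)) 0 m ^+ 2 - (x t i - zhat) 0 m ^+ 2) =
      \sum_m y 0 m ^+ 2 - delta *+ 2 * \sum_m (x t i 0 m - zhat 0 m) * e 0 m.
    by rewrite mulr_sumr -sumrB; apply: eq_bigr => m _; rewrite !mxE; ring.
  by rewrite (sum_diff predT) !mul1r; ring.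
have -> : (fun t => total k t - total l t) = (fun t =>
    (n%:R * (sqnorm y + delta * (zhat 0 k - zhat 0 l) *+ 2)
     - (V (zhat + y) t - V zhat t)) * (delta *+ 2)^-1).
  by apply/funext => t; rewrite Vdiff; field; lra.
apply: is_cvgM; last exact: is_cvg_cst.
by apply: is_cvgB; [exact: is_cvg_cst|apply: is_cvgB; exact: V_cvg].
Qed.

(* The totals add up to the constant [n * worth bm setT] from time 1 on; the
   initial allocations need not be efficient. *)
Let total_cvg l : cvgn (total l).
Proof.
have nR0 : n%:R != 0 :> R by rewrite pnatr_eq0 -lt0n.
(* The mean of the totals is the efficient amount, and [total l] differs from that mean by the
   average of the differences. *)
have totalE t : total l t.+1 = worth bm [set: 'I_n]%SET -
    n%:R^-1 * \sum_k (total k t.+1 - total l t.+1).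
  rewrite sumrB sumr_const card_ord -[total l t.+1 *+ n]mulr_natl mulrBr mulKf//.
  suff -> : \sum_k total k t.+1 = n%:R * worth bm [set: 'I_n]%SET by rewrite mulKf//; ring.
  rewrite exchange_big/= -[in n%:R](card_ord n) mulr_natl -sumr_const.
  apply: eq_bigr => i _; rewrite -(b_grand t); have [<- _] := allocation_bounding t i.
  by apply: eq_bigl => k; rewrite inE.
pose L k := limn (fun t => total k t - total l t).
have cvgL k : total k t - total l t @[t --> \oo] --> L k := total_diff_cvg k l.
apply/cvg_ex; exists (worth bm [set: 'I_n]%SET - n%:R^-1 * \sum_k L k).
rewrite -(cvg_shiftS (total l)); under eq_fun do rewrite totalE.
apply: cvgB; first exact: cvg_cst.
apply: cvgM; first exact: cvg_cst.
apply: cvg_big => [|k _]; first exact: add_continuous.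
by have := cvgL k; rewrite -(cvg_shiftS (fun t => total k t - total l t)).
Qed.

Lemma bargaining_cvg : exists z : 'rV[R]_n,
  core bm z /\ forall i k, x t i 0 k @[t --> \oo] --> z 0 k.
Proof.
have nR0 : n%:R != 0 :> R by rewrite pnatr_eq0 -lt0n.
pose z : 'rV[R]_n := \row_k (n%:R^-1 * limn (total k)).
have xz i k : x t i 0 k @[t --> \oo] --> z 0 k.
  rewrite mxE.
  (* An allocation is the mean of all allocations plus the averaged disagreements, which vanish in
     the limit. *)
  have -> : (fun t => x t i 0 k) =
      (fun t => n%:R^-1 * (total k t + \sum_j (x t i 0 k - x t j 0 k))).
    apply/funext => t; rewrite sumrB sumr_const card_ord addrC subrK.
    by rewrite -[x t i 0 k *+ n]mulr_natl mulKf.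
  apply: cvgM; first exact: cvg_cst.
  rewrite -[limn _]addr0; apply: cvgD; first exact: total_cvg.
  rewrite [X in _ --> X](_ : 0 = \sum_(j < n) 0); last by rewrite big1.
  by apply: cvg_big => [|j _]; [exact: add_continuous|exact: agreement].
(* The shift matters: only allocations produced by a projection, from time 1 on, satisfy bounding
   constraints. *)
have payoff_cvg i S : payoff (x t.+1 i) S @[t --> \oo] --> payoff z S.
  apply: cvg_big => [|k _]; first exact: add_continuous.
  by rewrite (cvg_shiftS (fun t => x t i 0 k)).
exists z; split=> //; split=> [|S S0 Sp].
  have := payoff_cvg (Ordinal n_gt0) [set: 'I_n]%SET.
  under eq_fun do rewrite (allocation_bounding _ _).1 b_grand.
  by move=> /(cvg_lim (@norm_hausdorff _ R)) <-; rewrite lim_cst.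
have /set0Pn[i iS] := S0.
apply: (ler_cvg_to (cvg_worth _ _ S cvg_b) (payoff_cvg i S)).
by apply: nearW => t; apply: (allocation_bounding t i).2.
Qed.

End Bargaining.

(** * Measurability of projections onto random polyhedra *)

Section MeasurableProjection.
Context {d : measure_display} {T : measurableType d} {R : realType} {n : nat}.
Variable G : set T.
Hypothesis mG : measurable G.

(** Open upper rays generate the Borel sets, and their preimages are the complements in [G] of
    sublevel sets. *)
Lemma measurable_fun_le_sets (f : T -> R) :
  (forall c, measurable (G `&` [set t | f t <= c])) -> measurable_fun G f.
Proof.
move=> mf _; apply: (measurability _ (RGenOInfty.measurableE R)) => // _ [_ [c ->] <-].
rewrite (_ : _ `&` _ = G `\` (G `&` [set t | f t <= c])); first exact: measurableD.
apply/seteqP; split=> t /=; rewrite in_itv/= andbT.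
  by move=> [Gt cf]; split=> // -[_]; rewrite leNgt cf.
by move=> [Gt nf]; split=> //; rewrite ltNge; apply/negP => fc; exact: nf.
Qed.

(** A strict inequality persists on a ball, and every ball contains a rational vector. *)
Lemma continuous_rational_lt (f : 'rV[R]_n -> R) z c : {for z, continuous f} -> f z < c ->
  exists q : 'rV[rat]_n, f (map_mx ratr q) < c.
Proof.
move=> fz fzc.
have : \forall y \near z, f y < c by exact: (cvgr_lt _ fz _ fzc).
move=> /nbhs_ballP[r /= r0 rf].
have rat_near k : exists q : rat, ratr q \in `]z 0 k - r, z 0 k + r[.
  by apply: rat_in_itvoo; lra.
have /choice[q qz] := rat_near.
exists (\row_k q k); apply: rf; split=> // a k.
by have := qz k; rewrite ord1 !mxE /ball/= in_itv/= ltr_distlC.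
Qed.

Lemma measurable_exists_le0 (g : T -> 'rV[R]_n -> R) :
  (forall z, measurable_fun G (g^~ z)) ->
  (forall t, G t -> continuous (g t)) ->
  (forall t, G t -> exists M, forall z, g t z <= 1 -> `|z| <= M) ->
  measurable (G `&` [set t | exists z, g t z <= 0]).
Proof.
move=> mg gc gM.
have -> : G `&` [set t | exists z, g t z <= 0] =
    \bigcap_m \bigcup_(q in [set: 'rV[rat]_n])
      (G `&` g^~ (map_mx ratr q) @^-1` [set r | r < m.+1%:R^-1]).
  apply/seteqP; split=> [t [Gt [z gz]] m _|t gt].
    have m0 : 0 < m.+1%:R^-1 :> R by rewrite invr_gt0.
    have [q gq] := continuous_rational_lt _ _ _ (gc t Gt z) (le_lt_trans gz m0).
    by exists q.
  (* Index 0 provides a point of value below 1, so its sublevel set is bounded and [g t] attains a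
     minimum. *)
  have [q0 _ [Gt gq0]] := gt 0%N I.
  split=> //=; have [M gtM] := gM t Gt.
  have gq1 : g t (map_mx ratr q0) <= 1 by rewrite ltW// -invr1.
  have [|y _ ymin] := closed_coercive_min (g t) setT (map_mx ratr q0) M (gc t Gt) closedT I.
    by move=> z gz; apply: gtM; exact: le_trans gz gq1.
  (* A positive minimum would exceed some [m.+1%:R^-1], against the rational point given for that
     [m]. *)
  exists y; rewrite leNgt; apply/negP => gy0.
  have [m _ /(_ m (leqnn m)) mgy] := near_infty_natSinv_lt (PosNum gy0).
  have [q _ [_ /= gq]] := gt m I.
  by have := ymin (map_mx ratr q) I; rewrite leNgt (lt_trans gq mgy).
apply: bigcapT_measurable => m; apply: countable_bigcupT_measurable => // q.
apply: mg => //.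
by rewrite (_ : [set r | _] = `]-oo, m.+1%:R^-1[%classic).
Qed.

Section Projection.
Variables (eta : T -> 'rV[R]_(ncoal n)) (u : T -> 'rV[R]_n) (i : 'I_n).
Hypothesis meta : forall c, measurable_fun G (fun t => eta t 0 c).
Hypothesis mu : forall k, measurable_fun G (fun t => u t 0 k).
Hypothesis eta_neq0 : forall t, G t -> bounding_set (eta t) i !=set0.

(** Twice the positive part of [a]; continuity and measurability come from those of the absolute
    value. *)
Let excess (a : R) := `|a| + a.

Let excess_ge0 a : 0 <= excess a.
Proof. by rewrite /excess; have := ler_norm (- a); rewrite normrN; lra. Qed.

Let excess_le0 a : (excess a <= 0) = (a <= 0).
Proof.
apply/idP/idP; rewrite /excess; first by have := normr_ge0 a; lra.
by move=> a0; rewrite ler0_norm// addNr.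
Qed.

Let excess_continuous (S : topologicalType) (f : S -> R) :
  continuous f -> continuous (fun s => excess (f s)).
Proof.
move=> fc; apply: continuous_add => // s.
by apply: cvg_norm; exact: fc.
Qed.

Let excess_measurable (f : T -> R) :
  measurable_fun G f -> measurable_fun G (fun t => excess (f t)).
Proof.
rewrite /excess => mf; apply: measurable_funD => //.
by apply: measurableT_comp mf; exact: normr_measurable.
Qed.

(** A nonnegative penalty, continuous in [z], vanishing exactly on the bounding set: it condenses
    all the constraints into one inequality. *)
Let violation t z :=
  `|payoff z [set: 'I_n]%SET - worth (eta t) [set: 'I_n]%SET| +
  \sum_(S : {set 'I_n})
    (if (S \proper [set: 'I_n]%SET) && (i \in S)
     then excess (worth (eta t) S - payoff z S) else 0).

Let violation_term_ge0 t z (S : {set 'I_n}) :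
  0 <= (if (S \proper [set: 'I_n]%SET) && (i \in S)
        then excess (worth (eta t) S - payoff z S) else 0).
Proof. by case: ifP. Qed.

Let violation_ge0 t z : 0 <= violation t z.
Proof. by rewrite addr_ge0// sumr_ge0. Qed.

Let violation_le0 t z : violation t z <= 0 <-> bounding_set (eta t) i z.
Proof.
split=> [|[zN zS]]; last first.
  rewrite /violation zN subrr normr0 add0r big1// => S _.
  case: ifP => // /andP[Sp iS]; apply/eqP.
  by rewrite eq_le excess_ge0 andbT excess_le0 subr_le0 zS.
rewrite /violation => viol.
have sum0 : 0 <= \sum_(S : {set 'I_n}) (if (S \proper [set: 'I_n]%SET) && (i \in S)
     then excess (worth (eta t) S - payoff z S) else 0) by rewrite sumr_ge0.
split=> [|S Sp iS].
  apply/eqP; rewrite -subr_eq0 -normr_le0.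
  by have := normr_ge0 (payoff z [set: 'I_n]%SET - worth (eta t) [set: 'I_n]%SET); lra.
rewrite -subr_le0 -excess_le0; apply: le_trans viol.
rewrite (bigD1 S)//= Sp iS/= addrCA lerDl addr_ge0// sumr_ge0//.
Qed.

Let violation_continuous t : continuous (violation t).
Proof.
apply: continuous_add.
  have grand : continuous (fun y : 'rV[R]_n =>
      payoff y [set: 'I_n]%SET - worth (eta t) [set: 'I_n]%SET).
    by apply: continuous_sub; [exact: continuous_payoff|exact: continuous_const].
  by move=> z; exact: (continuous_comp (grand z) (@norm_continuous _ _ _)).
apply: continuous_sum => S; case: (_ && _); last exact: continuous_const.
apply: excess_continuous.
by apply: continuous_sub; [exact: continuous_const|exact: continuous_payoff].
Qed.

Let worth_measurable S : measurable_fun G (fun t => worth (eta t) S).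
Proof.
have [[c wE]|wE] := @worthE R n S; under eq_fun do rewrite wE; last exact: measurable_cst.
exact: meta.
Qed.

Let violation_measurable z : measurable_fun G (violation^~ z).
Proof.
rewrite /violation; apply: measurable_funD.
  apply: measurableT_comp; first exact: normr_measurable.
  by apply: measurable_funB => //; exact: measurable_cst.
apply: measurable_sum => S; case: (_ && _); last exact: measurable_cst.
by apply: excess_measurable; apply: measurable_funB => //; exact: measurable_cst.
Qed.

Let sqdist_measurable (v : T -> 'rV[R]_n) :
  (forall k, measurable_fun G (fun t => v t 0 k)) ->
  measurable_fun G (fun t => sqnorm (u t - v t)).
Proof.
move=> mv; apply: measurable_sum => k; apply: measurable_funX.
by under eq_fun do rewrite !mxE; exact: measurable_funB.
Qed.

(* With [l = 0] this measures the sublevel sets of the distance to the bounding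
   set; with [r] that distance and [l z = z 0 k - c] it measures the event that
   the projection, as unique nearest point, has [k]-th coordinate at most [c]. *)
Let measurable_hits (r : T -> R) (l : 'rV[R]_n -> R) :
  measurable_fun G r -> continuous l ->
  measurable (G `&` [set t | exists z,
    [/\ bounding_set (eta t) i z, sqnorm (u t - z) <= r t & l z <= 0]]).
Proof.
move=> mr lc.
(* A sum of three nonnegative penalties is at most 0 exactly when all three conditions hold. *)
pose g t z := violation t z + (excess (sqnorm (u t - z) - r t) + excess (l z)).
have -> : [set t | exists z,
    [/\ bounding_set (eta t) i z, sqnorm (u t - z) <= r t & l z <= 0]] =
    [set t | exists z, g t z <= 0].
  apply/seteqP; split=> t [z].
    move=> [/violation_le0 zX zr zl]; exists z; rewrite /g.
    have : excess (sqnorm (u t - z) - r t) <= 0 by rewrite excess_le0 subr_le0.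
    have : excess (l z) <= 0 by rewrite excess_le0.
    lra.
  rewrite /g => gz; exists z.
  have := violation_ge0 t z; have := excess_ge0 (sqnorm (u t - z) - r t).
  have := excess_ge0 (l z) => g1 g2 g3.
  split; first by apply/violation_le0; lra.
    by rewrite -subr_le0 -excess_le0; lra.
  by rewrite -excess_le0; lra.
apply: measurable_exists_le0 => [z|t Gt|t Gt]; rewrite /g.
- apply: measurable_funD; first exact: violation_measurable.
  apply: measurable_funD; last exact: measurable_cst.
  apply: excess_measurable; apply: measurable_funB => //.
  by apply: sqdist_measurable => k; exact: measurable_cst.
- apply: continuous_add; first exact: violation_continuous.
  apply: continuous_add; last exact: excess_continuous.
  apply: excess_continuous.
  by apply: continuous_sub; [exact: continuous_sqdist|exact: continuous_const].
(* Since [a <= excess a], the bound [g t z <= 1] gives [sqnorm (u t - z) <= 1 + |r t|], and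
   [norm_le_sqdist] applies. *)
- exists (`|u t| + (1 + (1 + `|r t|))) => z; rewrite /g => gz.
  apply: norm_le_sqdist; first by rewrite addr_ge0.
  have := violation_ge0 t z; have := excess_ge0 (l z).
  have := ler_norm (r t).
  have := ler_norm (sqnorm (u t - z) - r t); have := normr_ge0 (sqnorm (u t - z) - r t).
  by move: gz; rewrite /excess; lra.
Qed.

Let p t := eproj (bounding_set (eta t) i) (u t).

Let p_nearest t : G t -> bounding_set (eta t) i (p t) /\
  forall z, bounding_set (eta t) i z -> sqnorm (u t - p t) <= sqnorm (u t - z).
Proof. by move=> Gt; apply: eproj_nearest; [exact: closed_bounding_set|exact: eta_neq0]. Qed.

Let distance_measurable : measurable_fun G (fun t => sqnorm (u t - p t)).
Proof.
apply: measurable_fun_le_sets => c.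
have := measurable_hits (cst c) (cst 0) (measurable_cst c) (continuous_const 0).
congr (measurable _); apply/seteqP; split=> t [Gt].
  by move=> [z [zX zc _]]; split=> //=; apply: le_trans zc; exact: (p_nearest t Gt).2.
by move=> /= pc; split=> //; exists (p t); split=> //; exact: (p_nearest t Gt).1.
Qed.

Lemma measurable_eproj k : measurable_fun G (fun t => p t 0 k).
Proof.
apply: measurable_fun_le_sets => c.
have lc : continuous (fun z : 'rV[R]_n => z 0 k - c).
  by apply: continuous_sub; [exact: continuous_coord|exact: continuous_const].
have := measurable_hits _ _ distance_measurable lc.
congr (measurable _); apply/seteqP; split=> t [Gt]; have [pX pmin] := p_nearest t Gt.
  move=> [z [zX zp]]; rewrite subr_le0 => zc; split=> //=.
  (* The point [z] is as near to [u t] as [p t] is, so the obtuse angle inequality leaves no room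
     for [sqnorm (p t - z) > 0]. *)
  suff -> : p t = z by [].
  have := nearest_obtuse _ _ _ _ (convex_bounding_set (eta t) i) pX pmin zX.
  have sqC : sqnorm (p t - u t) = sqnorm (u t - p t).
    by apply: eq_bigr => j _; rewrite !mxE; ring.
  rewrite sqC => pz; apply/eqP; rewrite -subr_eq0; apply/eqP/sqnorm_eq0.
  by apply/eqP; rewrite eq_le sqnorm_ge0 andbT; lra.
by move=> /= pc; split=> //; exists (p t); split=> //; rewrite subr_le0.
Qed.

End Projection.
End MeasurableProjection.

(** * The bargaining protocol *)

Lemma cvg_enorm {R : realType} {n : nat} (y : nat -> 'rV[R]_n) (z : 'rV[R]_n) :
  (forall k, y t 0 k @[t --> \oo] --> z 0 k) -> enorm (y t - z) @[t --> \oo] --> (0 : R).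
Proof.
move=> yz.
suff sq0 : \sum_k (y t - z) 0 k ^+ 2 @[t --> \oo] --> (0 : R).
  by have := cvg_comp _ _ sq0 (@sqrt_continuous R 0); rewrite sqrtr0.
rewrite [X in _ --> X](_ : 0 = \sum_(k < n) 0); last by rewrite big1.
apply: cvg_big => [|k _]; first exact: add_continuous.
have dist0 : y t 0 k - z 0 k @[t --> \oo] --> (0 : R).
  by rewrite -(subrr (z 0 k)); apply: cvgB => //; exact: cvg_cst.
under eq_fun do rewrite expr2 !mxE.
have : (y t 0 k - z 0 k) * (y t 0 k - z 0 k) @[t --> \oo] --> (0 * 0 : R) by exact: cvgM.
by rewrite mulr0.
Qed.

Theorem theorem3 (R : realType) (d : measure_display)
  (Omega : measurableType d) (P : probability Omega R)
  (n : nat) (n_gt0 : (0 < n)%N)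
  (v : nat -> Omega -> 'rV[R]_(ncoal n))
  (v_random : forall t, random_vector (v t))
  (bounding_neq0 : {ae P, forall w, forall (t : nat) (i : 'I_n),
     bounding_set (average (v ^~ w) t) i !=set0})
  (E : nat -> {set 'I_n * 'I_n})
  (E_refl : forall t (i : 'I_n), (i, i) \in E t)
  (A : nat -> 'M[R]_n)
  (A_link : forall t (i j : 'I_n), (i, j) \in E t -> 0 < A t i j)
  (A_nolink : forall t (i j : 'I_n), (i, j) \notin E t -> A t i j = 0)
  (A_stochastic : forall t, doubly_stochastic (A t))
  (A_diag : forall t i, 0 < A t i i)
  (A_lbound : exists2 alpha : R, 0 < alpha &
     forall t i j, 0 < A t i j -> alpha <= A t i j)
  (Q : nat) (Q_ge1 : (1 <= Q)%N)
  (E_connected : forall t,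
     strongly_connected (\bigcup_(t * Q <= tau < t.+1 * Q) E tau)%SET)
  (vmean : 'rV[R]_(ncoal n))
  (v_mean : {ae P, forall w, average (v ^~ w) t @[t --> \oo] --> vmean})
  (v_grand : {ae P, forall w, forall t,
     worth (v t w) [set: 'I_n]%SET = worth vmean [set: 'I_n]%SET})
  (zhat : 'rV[R]_n) (zhat_core : core vmean zhat)
  (zhat_strict : forall S : {set 'I_n}, S != finset.set0 ->
     S \proper [set: 'I_n]%SET -> worth vmean S < payoff zhat S)
  (x : nat -> 'I_n -> Omega -> 'rV[R]_n)
  (x0_random : forall i, random_vector (x 0%N i))
  (x0_indep : independent_families P (x 0%N) v)
  (x_protocol : {ae P, forall w, forall (t : nat) (i : 'I_n),
     x t.+1 i w =
       eproj (bounding_set (average (v ^~ w) t) i)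
            (\sum_j A t i j *: x t j w)}) :
  exists z : Omega -> 'rV[R]_n,
    [/\ random_vector z,
        forall w, core vmean (z w) &
        {ae P, forall w, forall i : 'I_n,
          enorm (x t i w - z w) @[t --> \oo] --> (0 : R)}].
Proof.
(* One measurable null set [N] contains every outcome at which some almost sure hypothesis fails. *)
have [N [mN PN0 goodN]] :=
  filterI bounding_neq0 (filterI v_mean (filterI v_grand x_protocol)).
pose G := ~` N; have mG : measurable G by exact: measurableC.
have good w : G w -> [/\ forall t i, bounding_set (average (v ^~ w) t) i !=set0,
    average (v ^~ w) t @[t --> \oo] --> vmean,
    forall t, worth (average (v ^~ w) t) [set: 'I_n]%SET = worth vmean [set: 'I_n]%SET &
    forall t i, x t.+1 i w = eproj (bounding_set (average (v ^~ w) t) i)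
      (\sum_j A t i j *: x t j w)].
  move=> Gw; have [w0 [wm [wg wp]]] : _ w := contrapT (fun nw => Gw (goodN _ nw)).
  by split=> // t; apply: worth_average => k; exact: wg.
have mv c t : measurable_fun G (fun w => average (v ^~ w) t 0 c).
  under eq_fun do rewrite mxE summxE.
  apply: measurable_funM; first exact: measurable_cst.
  by apply: measurable_sum => k; apply: measurable_funTS; exact: v_random.
(* Only the initial allocations are assumed measurable, and the protocol holds
   only almost surely, hence measurability on [G] alone. *)
have mx t : forall i k, measurable_fun G (fun w => x t i w 0 k).
  elim: t => [|t IHt] i k; first by apply: measurable_funTS; exact: x0_random.
  have mw l : measurable_fun G (fun w => (\sum_j A t i j *: x t j w) 0 l).
    under eq_fun do rewrite summxE.
    apply: measurable_sum => j; under eq_fun do rewrite mxE.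
    by apply: measurable_funM; [exact: measurable_cst|exact: IHt].
  have bounding_G w : G w -> bounding_set (average (v ^~ w) t) i !=set0.
    by move=> /good[].
  apply: eq_measurable_fun (measurable_eproj G mG _ _ i (mv^~ t) mw bounding_G k).
  by move=> w; rewrite inE => /good[_ _ _ ->].
have [alpha alpha0 A_alpha] := A_lbound.
have converge w : G w -> exists z : 'rV[R]_n,
    core vmean z /\ forall i k, x t i w 0 k @[t --> \oo] --> z 0 k.
  move=> /good[w0 wm wg wp].
  apply: (bargaining_cvg E A alpha Q n_gt0 E_refl A_stochastic alpha0 _ Q_ge1
    E_connected _ vmean wm wg w0 zhat zhat_core.1 zhat_strict _ wp).
  by move=> t i j /A_link/A_alpha.
pose i0 := Ordinal n_gt0.
(* Any player may define the limit on [G], since all share it. Off [G] the value [zhat] keeps [z w]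
   in the core for every outcome. *)
pose z w : 'rV[R]_n :=
  if w \in G then \row_k limn (fun t => x t i0 w 0 k) else zhat.
have zP w : G w -> core vmean (z w) /\ forall i k, x t i w 0 k @[t --> \oo] --> z w 0 k.
  move=> Gw; have [y [yc xy]] := converge w Gw.
  suff -> : z w = y by [].
  rewrite /z mem_set//; apply/rowP => k; rewrite mxE.
  exact: (cvg_lim (@norm_hausdorff _ R) (xy i0 k)).
exists z; split.
(* On [G] the coordinate is a pointwise limit of measurable functions; on the complement it is
   constant. *)
- move=> k; rewrite -(setvU G); apply/measurable_funU => //; first exact: measurableC.
  split.
    apply: (@eq_measurable_fun _ _ _ _ _ (cst (zhat 0 k))); last exact: measurable_cst.
    by move=> w; rewrite inE /z => nG; rewrite memNset.
  by apply: (@measurable_fun_cvg _ _ _ _ (fun t w => x t i0 w 0 k)) => // w /zP[_].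
- move=> w; have [/zP[]//|nG] := pselect (G w).
  by rewrite /z memNset.
- exists N; split=> // w /= nw; apply: contrapT => Nw; apply: nw => i.
  by apply: cvg_enorm => k; have [_] := zP w Nw.
Qed.
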